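(* Let $K$ be a function field in one variable of characteristic $p>0$ over a field $F$ algebraically closed in $K$. Let $t\in K\setminus F$ be an element which is not a $p$-th power in $K$ and which has at least one simple zero or simple pole (i.e. some prime $\mathfrak{q}$ of $K$ with $\mathrm{ord}_{\mathfrak q}t=\pm1$). Suppose that $p(K,t)=\{x\in K:\exists s\in\mathbb{Z}_{>0},\ x=t^{p^s}\}$ is definable in $K$. Then the structure $\langle \mathbb{Z}_{>0},+,\mid\rangle$ has a model in $K$; specifically, under the bijection $s\mapsto t^{p^s}$ from $\mathbb{Z}_{>0}$ onto $p(K,t)$, the graphs of addition and of divisibility correspond to definable subsets of $K^3$ and $K^2$ respectively.
   Context: ''Definable in $K$'' means first-order definable in the language of rings with finitely many parameters from $K$. A model of $\langle\mathbb{Z}_{>0},+,\mid\rangle$ in $K$ is a bijection $\phi$ from $\mathbb{Z}_{>0}$ onto a definable subset $D\subseteq K^d$ (some $d\ge1$) such that the images under $\phi$ of the graph of $+$ and of the divisibility relation $\mid$ are definable subsets of $D^3$ and $D^2$ respectively. *)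

(* Defs.v *)
From HB Require Import structures.
From mathcomp Require Import all_boot all_order all_algebra.
Set Implicit Arguments. Unset Strict Implicit. Unset Printing Implicit Defensive.
Import Order.TTheory GRing.Theory Num.Theory.
Local Open Scope ring_scope.

(* The constant field F is given as a field F with an (injective) ring
   embedding iota : F -> K. *)

Definition transcendental_over (F K : fieldType) (iota : {rmorphism F -> K}) (x : K) :=
  forall q : {poly F}, root (map_poly iota q) x -> q = 0.

(* K is a function field in one variable over F: there is x in K transcendental
   over F such that K is a finite-dimensional vector space over F(x), i.e.
   spanned over F(x) by finitely many elements b_0..b_{n-1}. *)
Definition function_field_one_var (F K : fieldType) (iota : {rmorphism F -> K}) :=
  exists x : K, transcendental_over iota x /\
  exists (n : nat) (b : 'I_n -> K), forall y : K,
    exists (q : {poly F}) (a : 'I_n -> {poly F}),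
      (map_poly iota q).[x] != 0 /\
      y * (map_poly iota q).[x] = \sum_(i < n) (map_poly iota (a i)).[x] * b i.

Definition alg_closed_in (F K : fieldType) (iota : {rmorphism F -> K}) :=
  forall y : K, (exists q : {poly F}, q != 0 /\ root (map_poly iota q) y) ->
    exists c : F, y = iota c.

(* A prime q of K (over F), represented by its normalized discrete valuation
   ord_q : K^x ->> Z, trivial on F^x (value at 0 irrelevant). *)
Definition prime_valuation (F K : fieldType) (iota : {rmorphism F -> K}) (v : K -> int) :=
  [/\ forall x y : K, x != 0 -> y != 0 -> v (x * y) = v x + v y,
      forall x y : K, x != 0 -> y != 0 -> x + y != 0 -> Num.min (v x) (v y) <= v (x + y),
      forall c : F, c != 0 -> v (iota c) = 0
    & forall n : int, exists x : K, x != 0 /\ v x = n].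

(* First-order definability in the language of rings with parameters from K:
   S ⊆ K^d is definable iff it is defined by a formula whose free variables
   are among 'X_0..'X_(d-1) (parameters appear as constants c%:T). *)
Definition definable (K : fieldType) (d : nat) (S : d.-tuple K -> Prop) :=
  exists f : GRing.formula K, forall x : d.-tuple K, S x <-> GRing.holds (tval x) f.

(* Main.v *)
(** Let w be t or t^-1, chosen to have a simple pole at a place v, and let
    E(s) = w^(p^s). Modulo the Artin-Schreier group {r^p - r}, a p-th power of f
    equals f, so E(c) E(a) is congruent to w^(p^|c-a| + 1); pole orders show that
    the w^(p^e + 1), e >= 0, are pairwise incongruent. Hence |c-a| = b is
    definable, and c = a + b iff |c-a| = b and |c-b| = a.

    For divisibility put q = p^2 and code a finite set S of positive integers by
    u = sum_(s in S) w^(q^s). In the additive group K modulo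
    {r^q - r + w g^q}, the product u w^(q^c) is w^2 if c is in S and 0 otherwise,
    and w^2 is not 0 because its pole order 2 is neither 0 nor 1 modulo q. Finally
    a | b iff some u codes a set which contains b and, with every c <> a, also
    c - a: for a | b take S = {a, 2a, ..., b}, and conversely descend from b. *)

Require Import Defs.
From HB Require Import structures.
From mathcomp Require Import all_boot all_order all_algebra.
From mathcomp Require Import zify ring.
Import Order.TTheory GRing.Theory Num.Theory.
Local Open Scope ring_scope.

(** * Closure properties of first-order definable relations *)

Section FirstOrder.

Variable K : fieldType.
Implicit Types (e xs : seq K) (u : GRing.term K) (ts us : seq (GRing.term K)).

(* Quantifying over the argument terms makes the notion closed under
   substitution without renaming bound variables inside formulas. *)
Definition first_order (R : seq K -> Prop) := forall ts,
  exists f : GRing.formula K,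
    forall e, GRing.holds e f <-> R (map (GRing.eval e) ts).

Lemma eval_agree u : exists N, forall e e',
  (forall i, (i < N)%N -> e`_i = e'`_i) -> GRing.eval e u = GRing.eval e' u.
Proof.
elim: u => [i|x|n|u [N HN] u' [N' HN']|u [N HN]|u [N HN] n|u [N HN] u' [N' HN']
           |u [N HN]|u [N HN] n] /=; try by exists 0%N.
- by exists i.+1 => e e' ee'; apply: ee'.
- exists (maxn N N') => e e' ee'; congr (_ + _); [apply: HN | apply: HN'];
  by move=> i lt_i; apply: ee'; rewrite leq_max lt_i ?orbT.
- by exists N => e e' /HN ->.
- by exists N => e e' /HN ->.
- exists (maxn N N') => e e' ee'; congr (_ * _); [apply: HN | apply: HN'];
  by move=> i lt_i; apply: ee'; rewrite leq_max lt_i ?orbT.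
- by exists N => e e' /HN ->.
- by exists N => e e' /HN ->.
Qed.

Lemma evals_agree ts : exists N, forall e e',
  (forall i, (i < N)%N -> e`_i = e'`_i) ->
  map (GRing.eval e) ts = map (GRing.eval e') ts.
Proof.
elim: ts => [|u ts [N HN]]; first by exists 0%N.
have [N' HN'] := eval_agree u.
exists (maxn N N') => e e' ee' /=; congr (_ :: _); [apply: HN' | apply: HN];
by move=> i lt_i; apply: ee'; rewrite leq_max lt_i ?orbT.
Qed.

(** Terms mention finitely many variables, so any larger index is fresh and can be quantified
    without capture. Having [0 < N] keeps it apart from ['X_0], which [definable1_first_order] binds
    separately. *)
Lemma evals_fresh ts : exists2 N, (0 < N)%N & forall e y,
  map (GRing.eval (set_nth 0 e N y)) ts = map (GRing.eval e) ts.
Proof.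
have [N HN] := evals_agree ts; exists N.+1 => // e y; apply: HN => i lt_i.
by rewrite nth_set_nth /= ltn_eqF // ltnW.
Qed.

(** One direction suffices because agreement of environments is symmetric; negation and the premise
    of an implication use it backwards. Under a quantifier the bound [N] is kept, as both
    environments receive the same update. *)
Lemma holds_agree (f : GRing.formula K) : exists N, forall e e',
  (forall i, (i < N)%N -> e`_i = e'`_i) -> GRing.holds e f -> GRing.holds e' f.
Proof.
have agree_set N e e' i y : (forall j, (j < N)%N -> e`_j = e'`_j) ->
    forall j, (j < N)%N -> (set_nth 0 e i y)`_j = (set_nth 0 e' i y)`_j.
  by move=> ee' j lt_j; rewrite !nth_set_nth /=; case: eqP => // _; apply: ee'.
have agree_max N N' e e' : (forall j, (j < maxn N N')%N -> e`_j = e'`_j) ->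
    (forall j, (j < N)%N -> e`_j = e'`_j) /\ (forall j, (j < N')%N -> e`_j = e'`_j).
  by move=> ee'; split=> j lt_j; apply: ee'; rewrite leq_max lt_j ?orbT.
have agree_sym N e e' : (forall j, (j < N)%N -> e`_j = e'`_j) ->
    (forall j, (j < N)%N -> e'`_j = e`_j) by move=> ee' j /ee'.
elim: f => [b|u u'|u|f [N HN] f' [N' HN']|f [N HN] f' [N' HN']
  |f [N HN] f' [N' HN']|f [N HN]|i f [N HN]|i f [N HN]] /=; first by exists 0%N.
- have [[N HN] [N' HN']] := (eval_agree u, eval_agree u').
  by exists (maxn N N') => e e' /agree_max[/HN -> /HN' ->].
- by have [N HN] := eval_agree u; exists N => e e' /HN ->.
- exists (maxn N N') => e e' /agree_max[eN eN'] [h h'].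
  by split; [apply: HN h | apply: HN' h'].
- exists (maxn N N') => e e' /agree_max[eN eN'] [h|h'].
    by left; apply: HN h.
  by right; apply: HN' h'.
- exists (maxn N N') => e e' /agree_max[eN eN'] hh' h.
  by apply: HN' (eN') (hh' _); apply: HN h; apply: agree_sym.
- by exists N => e e' eN h h'; apply: h; apply: HN h'; apply: agree_sym.
- by exists N => e e' eN [y h]; exists y; apply: HN h; apply: agree_set.
- by exists N => e e' eN h y; apply: HN (h y); apply: agree_set.
Qed.

(** Definability of a subset of K tests [f] only on lists of length one, where every variable but
    ['X_0] takes the default value 0. Substituting 0 for those variables frees the formula from the
    rest of the environment. *)
Lemma only_var0 (f : GRing.formula K) : exists g : GRing.formula K,
  forall e, GRing.holds e g <-> GRing.holds [:: e`_0] f.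
Proof.
have [N HN] := holds_agree f.
(* The variables from 1 to [n] are set to 0 one at a time; a list of length [N] is enough, since [f]
   sees no further. *)
have kill n : exists g : GRing.formula K, forall e, GRing.holds e g <->
    GRing.holds [seq if (0 < i <= n)%N then 0 else e`_i | i <- iota 0 N] f.
  elim: n => [|n [g Hg]].
    exists f => e; split; apply: HN => i lt_i;
    by rewrite (nth_map 0%N) ?size_iota // nth_iota // add0n; case: i lt_i.
  exists (GRing.fsubst g (n.+1, GRing.Const 0)) => e.
  rewrite GRing.holds_fsubst Hg.
  suff -> : [seq (if (0 < i <= n)%N then 0 else (set_nth 0 e n.+1 0)`_i) | i <- iota 0 N]
    = [seq (if (0 < i <= n.+1)%N then 0 else e`_i) | i <- iota 0 N] by [].
  apply: eq_map => i; rewrite nth_set_nth /= (leq_eqVlt i n.+1) ltnS.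
  by case: eqP => [-> | _] //=; case: ifP.
have [g Hg] := kill N; exists g => e; rewrite Hg.
have E i : (i < N)%N ->
    [seq if (0 < i <= N)%N then 0 else e`_i | i <- iota 0 N]`_i = [:: e`_0]`_i.
  move=> lt_i; rewrite (nth_map 0%N) ?size_iota // nth_iota // add0n.
  by case: i lt_i => [|i] //= /ltnW ->; rewrite nth_nil.
by split; apply: HN => i /E.
Qed.

Lemma first_order_ext (R R' : seq K -> Prop) :
  (forall xs, R xs <-> R' xs) -> first_order R -> first_order R'.
Proof. by move=> RR' fR ts; have [f Hf] := fR ts; exists f => e; rewrite Hf. Qed.

Lemma term_subst ts u : exists u', forall e,
  GRing.eval (map (GRing.eval e) ts) u = GRing.eval e u'.
Proof.
elim: u => [i|x|n|u1 [u1' E1] u2 [u2' E2]|u [u' E]|u [u' E] n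
           |u1 [u1' E1] u2 [u2' E2]|u [u' E]|u [u' E] n] /=.
(* The default term 0 matches the value 0 of a variable beyond the end of the environment. *)
- exists (nth (GRing.Const 0) ts i) => e; have [lt_i|le_i] := ltnP i (size ts).
    by rewrite (nth_map (GRing.Const 0)).
  by rewrite !nth_default ?size_map.
- by exists (GRing.Const x).
- by exists (GRing.NatConst K n).
- by exists (GRing.Add u1' u2') => e /=; rewrite E1 E2.
- by exists (GRing.Opp u') => e /=; rewrite E.
- by exists (GRing.NatMul u' n) => e /=; rewrite E.
- by exists (GRing.Mul u1' u2') => e /=; rewrite E1 E2.
- by exists (GRing.Inv u') => e /=; rewrite E.
- by exists (GRing.Exp u' n) => e /=; rewrite E.
Qed.

Lemma first_order_subst (R : seq K -> Prop) us :
  first_order R -> first_order (fun xs => R (map (GRing.eval xs) us)).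
Proof.
move=> fR ts; have [us' Eus] : exists us', forall e,
    map (GRing.eval (map (GRing.eval e) ts)) us = map (GRing.eval e) us'.
  elim: us => [|u us [us' Eus]]; first by exists [::].
  have [u' Eu] := term_subst ts u; exists (u' :: us') => e /=.
  by rewrite Eu Eus.
by have [f Hf] := fR us'; exists f => e; rewrite Hf Eus.
Qed.

Lemma first_order_eq u u' :
  first_order (fun xs => GRing.eval xs u = GRing.eval xs u').
Proof.
move=> ts; have [[w Ew] [w' Ew']] := (term_subst ts u, term_subst ts u').
by exists (w == w')%T => e /=; rewrite Ew Ew'.
Qed.

Lemma first_order_and (R R' : seq K -> Prop) :
  first_order R -> first_order R' -> first_order (fun xs => R xs /\ R' xs).
Proof.
move=> fR fR' ts; have [[f Hf] [f' Hf']] := (fR ts, fR' ts).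
by exists (f /\ f')%T => e /=; rewrite Hf Hf'.
Qed.

Lemma first_order_or (R R' : seq K -> Prop) :
  first_order R -> first_order R' -> first_order (fun xs => R xs \/ R' xs).
Proof.
move=> fR fR' ts; have [[f Hf] [f' Hf']] := (fR ts, fR' ts).
by exists (f \/ f')%T => e /=; rewrite Hf Hf'.
Qed.

Lemma first_order_imp (R R' : seq K -> Prop) :
  first_order R -> first_order R' -> first_order (fun xs => R xs -> R' xs).
Proof.
move=> fR fR' ts; have [[f Hf] [f' Hf']] := (fR ts, fR' ts).
by exists (f ==> f')%T => e /=; rewrite Hf Hf'.
Qed.

Lemma first_order_not (R : seq K -> Prop) :
  first_order R -> first_order (fun xs => ~ R xs).
Proof.
by move=> fR ts; have [f Hf] := fR ts; exists (~ f)%T => e /=; rewrite Hf.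
Qed.

(** The bound variable is fresh for the argument terms, which therefore keep their values while it
    ranges over K. *)
Lemma first_order_ex (R : seq K -> Prop) :
  first_order R -> first_order (fun xs => exists y, R (y :: xs)).
Proof.
move=> fR ts; have [N _ HN] := evals_fresh ts.
have [f Hf] := fR ('X_N :: ts)%T; exists ('exists 'X_N, f)%T => e /=.
by split=> -[y Hy]; exists y; move: Hy; rewrite Hf /= HN nth_set_nth /= eqxx.
Qed.

Lemma first_order_all (R : seq K -> Prop) :
  first_order R -> first_order (fun xs => forall y, R (y :: xs)).
Proof.
move=> fR ts; have [N _ HN] := evals_fresh ts.
have [f Hf] := fR ('X_N :: ts)%T; exists ('forall 'X_N, f)%T => e /=.
by split=> Hy y; move: (Hy y); rewrite Hf /= HN nth_set_nth /= eqxx.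
Qed.

(** The given formula speaks about ['X_0], which may itself occur in the argument term [u]. The
    value of [u] is therefore stored in a fresh ['X_N] first, and only then is ['X_0] rebound to
    that value. *)
Lemma definable1_first_order (S : K -> Prop) :
  definable (fun x : 1.-tuple K => S (tnth x ord0)) ->
  first_order (fun xs => S xs`_0).
Proof.
move=> [f Hf] ts; have [g Hg] := only_var0 f.
set u := nth (GRing.Const 0) ts 0.
have [N N_gt0 HN] := evals_fresh [:: u].
exists ('exists 'X_N, 'X_N == u /\ 'exists 'X_0, 'X_0 == 'X_N /\ g)%T => e /=.
have -> : (map (GRing.eval e) ts)`_0 = GRing.eval e u.
  by rewrite /u; case: (ts).
have S_holds y : S y <-> GRing.holds [:: y] f by apply: (Hf [tuple y]).
have HNu y : GRing.eval (set_nth 0 e N y) u = GRing.eval e u.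
  by have [] := HN e y.
have E0 y z : (set_nth 0 (set_nth 0 e N y) 0 z)`_0 = z by rewrite nth_set_nth.
have EN y z : (set_nth 0 (set_nth 0 e N y) 0 z)`_N = y.
  by rewrite nth_set_nth /= -[_ == _]negbK -lt0n N_gt0 /= nth_set_nth /= eqxx.
split.
  move=> [y []]; rewrite HNu nth_set_nth /= eqxx => -> [z []].
  by rewrite EN E0 => ->; rewrite Hg E0 -S_holds.
move=> Su; exists (GRing.eval e u); rewrite HNu nth_set_nth /= eqxx; split=> //.
by exists (GRing.eval e u); rewrite EN Hg E0 -S_holds.
Qed.

Lemma first_order_definable d (R : seq K -> Prop) :
  first_order R -> definable (fun x : d.-tuple K => R x).
Proof.
move=> fR; have [f Hf] := fR [seq 'X_i | i <- iota 0 d]%T.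
exists f => x; rewrite Hf -map_comp.
suff -> : [seq (GRing.eval x \o GRing.Var K) i | i <- iota 0 d] = x by [].
rewrite -[RHS](mkseq_nth 0) size_tuple; exact: eq_map.
Qed.

End FirstOrder.

(** * Congruences modulo Artin-Schreier groups *)

Definition artin_schreier (K : fieldType) (q : nat) (f : K) :=
  exists r, f = r ^+ q - r.

(** The extra summand [w * g ^+ q] absorbs every [w ^+ (q ^ e + 1)] with [e > 0], so that only
    distance 0, that is [w ^+ 2], can be detected. *)
Definition artin_schreier_mod (K : fieldType) (w : K) (q : nat) (f : K) :=
  exists r g, f = r ^+ q - r + w * g ^+ q.

Lemma mulz_neq_small (q : nat) (m c : int) :
  (0 < `|c| < q)%N -> q%:Z * m <> c.
Proof.
move=> /andP[c_gt0 c_lt] /(congr1 absz); rewrite abszM absz_nat => E.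
by move: c_gt0 c_lt; rewrite -E; case: `|m|%N => [|n]; rewrite ?muln0 // mulnS; lia.
Qed.

Section ArtinSchreier.

Variables (K : fieldType) (q : nat).
Hypothesis charq : [pchar K].-nat q.
Implicit Types (f g w : K).

Let q_gt0 : (0 < q)%N. Proof. by case/andP: charq. Qed.

Lemma frobeniusB f g : (f - g) ^+ q = f ^+ q - g ^+ q.
Proof. by rewrite exprDn_pchar // exprNn_pchar. Qed.

Lemma artin_schreierB f g :
  artin_schreier K q f -> artin_schreier K q g -> artin_schreier K q (f - g).
Proof. by move=> [r ->] [s ->]; exists (r - s); rewrite frobeniusB; ring. Qed.

(** The difference telescopes: [r] is the sum of the [f ^+ (q ^ i)] for [i < n]. *)
Lemma artin_schreier_frobenius f n : artin_schreier K q (f ^+ (q ^ n) - f).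
Proof.
elim: n => [|n [r Hr]].
  by exists 0; rewrite expr1 subrr subr0 expr0n gtn_eqF.
exists (r + f ^+ (q ^ n)).
rewrite exprDn_pchar // -exprM -expnSr.
by apply/eqP; rewrite -subr_eq0; apply/eqP; rewrite -(subrr (r ^+ q - r)) -{1}Hr; ring.
Qed.

(** With truncated subtraction, [(i - j) + (j - i)] is |i - j|. Factoring the smaller power of [q]
    out of the exponent exhibits the first monomial as an iterated Frobenius image of the second. *)
Lemma artin_schreier_monomial w i j :
  artin_schreier K q
    (w ^+ (q ^ i + q ^ j) - w ^+ (q ^ ((i - j) + (j - i)) + 1)).
Proof.
wlog le_ij : i j / (i <= j)%N.
  move=> IH; case/orP: (leq_total i j) => /IH //.
  by rewrite (addnC (q ^ j)%N) (addnC (j - i)%N).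
have -> : (q ^ i + q ^ j = (q ^ ((i - j) + (j - i)) + 1) * q ^ i)%N.
  by rewrite (eqP le_ij) add0n mulnDl -expnD subnK // mul1n addnC.
by rewrite exprM; apply: artin_schreier_frobenius.
Qed.

Lemma artin_schreier_modW w f : artin_schreier K q f -> artin_schreier_mod K w q f.
Proof. by move=> [r ->]; exists r, 0; rewrite expr0n gtn_eqF // mulr0 addr0. Qed.

Lemma artin_schreier_mod0 w : artin_schreier_mod K w q 0.
Proof. by exists 0, 0; rewrite expr0n gtn_eqF //=; ring. Qed.

Lemma artin_schreier_modB w f g : artin_schreier_mod K w q f ->
  artin_schreier_mod K w q g -> artin_schreier_mod K w q (f - g).
Proof.
by move=> [r [s ->]] [r' [s' ->]]; exists (r - r'), (s - s'); rewrite !frobeniusB; ring.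
Qed.

Lemma artin_schreier_modD w f g : artin_schreier_mod K w q f ->
  artin_schreier_mod K w q g -> artin_schreier_mod K w q (f + g).
Proof.
by move=> [r [s ->]] [r' [s' ->]]; exists (r + r'), (s + s');
  rewrite !exprDn_pchar //; ring.
Qed.

Lemma artin_schreier_mod_monomial w i c :
  artin_schreier_mod K w q
    (w ^+ (q ^ i) * w ^+ (q ^ c) - (if i == c then w ^+ 2 else 0)).
Proof.
rewrite -exprD; have := artin_schreier_modW w _ (artin_schreier_monomial w i c).
case: eqP => [-> | ne_ic]; first by rewrite !subnn.
have : (0 < i - c + (c - i))%N by lia.
case: (i - c + (c - i))%N => // e _ /artin_schreier_modD H.
rewrite subr0 -[X in artin_schreier_mod _ _ _ X](subrK (w ^+ (q ^ e.+1 + 1))).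
apply: H; exists 0, (w ^+ (q ^ e)).
by rewrite expr0n gtn_eqF // subrr add0r -exprM -expnSr exprD mulrC.
Qed.

(* Modulo the subgroup, the product is [w ^+ 2] if [c] is in [s] and 0 otherwise. *)
Lemma artin_schreier_mod_code w (s : seq nat) c : uniq s ->
  ~ artin_schreier_mod K w q (w ^+ 2) ->
  ~ artin_schreier_mod K w q ((\sum_(i <- s) w ^+ (q ^ i)) * w ^+ (q ^ c)) <->
  c \in s.
Proof.
move=> s_uniq w2.
have : artin_schreier_mod K w q ((\sum_(i <- s) w ^+ (q ^ i)) * w ^+ (q ^ c)
    - (if c \in s then w ^+ 2 else 0)).
  have -> : (if c \in s then w ^+ 2 else 0) =
      \sum_(i <- s) (if i == c then w ^+ 2 else 0).
    (* As [s] has no repetitions, [w ^+ 2] is counted at most once; repeated terms could cancel in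
       positive characteristic. *)
    rewrite -big_mkcond; case: ifP => [c_s | /negbT c_s].
      by rewrite -big_filter filter_pred1_uniq // big_seq1.
    by rewrite big1_seq // => i /andP[/eqP -> c_s']; rewrite c_s' in c_s.
  rewrite mulr_suml -sumrB; elim/big_rec: _ => [|i f _].
    exact: artin_schreier_mod0.
  exact/artin_schreier_modD/artin_schreier_mod_monomial.
case: ifP => c_s H; split=> //; last by rewrite subr0 in H.
by move=> _ H'; apply: w2; have := artin_schreier_modB _ _ _ H' H; rewrite subKr.
Qed.

End ArtinSchreier.

(** * Pole orders and incongruence of monomials *)

Section Valuation.

Variables (K : fieldType) (v : K -> int).
Hypothesis vM : forall x y : K, x != 0 -> y != 0 -> v (x * y) = v x + v y.
Hypothesis vD : forall x y : K, x != 0 -> y != 0 -> x + y != 0 ->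
  Num.min (v x) (v y) <= v (x + y).

Lemma valX x n : x != 0 -> v (x ^+ n) = n%:Z * v x.
Proof.
move=> x0; elim: n => [|n IHn].
  by have := vM 1 1 (oner_neq0 _) (oner_neq0 _); rewrite mulr1 expr0; lia.
by rewrite exprS vM ?expf_neq0 // IHn; lia.
Qed.

Lemma valN x : x != 0 -> v (- x) = v x.
Proof.
move=> x0; have n1 : (-1 : K) != 0 by rewrite oppr_eq0 oner_neq0.
have := valX 1 0 (oner_neq0 _); rewrite expr0 mul0r => v1.
have vN1 : v (-1) = 0 by have := vM _ _ n1 n1; rewrite mulrNN mulr1 v1; lia.
by rewrite -mulN1r vM // vN1 add0r.
Qed.

Lemma valD_ge x y : x != 0 -> y != 0 -> x + y != 0 ->
  (v x <= v (x + y)) || (v y <= v (x + y)).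
Proof. by move=> x0 y0 xy0; rewrite -ge_min; apply: vD. Qed.

(** The reverse inequality comes from the ultrametric law applied to x = (x + y) - y. *)
Lemma val_lt x y : x != 0 -> y != 0 -> v x < v y ->
  x + y != 0 /\ v (x + y) = v x.
Proof.
move=> x0 y0 lt_xy; have xy0 : x + y != 0.
  by apply: contraTneq lt_xy => /eqP; rewrite addr_eq0 => /eqP ->; rewrite valN // ltxx.
split=> //; move: lt_xy; have := valD_ge _ _ x0 y0 xy0.
have := valD_ge (x + y) (- y); rewrite addrK oppr_eq0 valN // => /(_ xy0 y0 x0).
lia.
Qed.

(** If [r] has a pole, [r ^+ q] dominates; otherwise [r ^+ q - r] has no pole at all. *)
Lemma val_artin_schreier q r : (1 < q)%N -> r ^+ q - r != 0 ->
  v (r ^+ q - r) < 0 -> exists m : int, v (r ^+ q - r) = q%:Z * m.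
Proof.
move=> q1 h0; have r0 : r != 0.
  by apply: contraNneq h0 => ->; rewrite expr0n gtn_eqF ?subrr // ltnW.
have rN0 : - r != 0 by rewrite oppr_eq0.
have rq0 : r ^+ q != 0 by rewrite expf_neq0.
have [vr|vr] := ltP (v r) 0 => vh.
  have [] := val_lt _ _ rq0 rN0; first by rewrite valX // valN //; nia.
  by move=> _ ->; exists (v r); rewrite valX.
have qvr : 0 <= q%:Z * v r by rewrite mulr_ge0.
by exfalso; case/orP: (valD_ge _ _ rq0 rN0 h0); rewrite ?valX // ?valN // => /le_lt_trans/(_ vh); lia.
Qed.

(** A pole of [r ^+ q - r] has order 0 modulo [q] and one of [w * g ^+ q] has order 1, so leading
    terms cannot cancel and the larger pole survives. *)
Lemma val_artin_schreier_mod w q f : (1 < q)%N -> w != 0 -> v w = -1 ->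
  f != 0 -> v f < 0 -> artin_schreier_mod K w q f ->
  exists m : int, v f = q%:Z * m \/ v f = q%:Z * m - 1.
Proof.
move=> q1 w0 vw f0 vf [r [g Ef]].
have [g0|g0] := eqVneq g 0.
  have Er : f = r ^+ q - r.
    by rewrite Ef g0 expr0n gtn_eqF ?mulr0 ?addr0 // ltnW.
  have := val_artin_schreier q r q1; rewrite -Er => /(_ f0 vf) [m Em].
  by exists m; left.
have wg0 : w * g ^+ q != 0 by rewrite mulf_neq0 ?expf_neq0.
have vwg : v (w * g ^+ q) = q%:Z * v g - 1 by rewrite vM ?expf_neq0 // valX // vw; lia.
have [h0|h0] := eqVneq (r ^+ q - r) 0.
  by exists (v g); right; rewrite Ef h0 add0r.
have vAS := val_artin_schreier q r q1 h0.
move: f0 vf (valD_ge _ _ h0 wg0); rewrite Ef => f0 vf /(_ f0) v_ge.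
have [lt_h|gt_h|E] := ltgtP (v (r ^+ q - r)) (v (w * g ^+ q)).
- have [_ E] := val_lt _ _ h0 wg0 lt_h.
  by rewrite E in vf *; have [m ->] := vAS vf; exists m; left.
- have [_ E] := val_lt _ _ wg0 h0 gt_h.
  by exists (v g); right; rewrite addrC E.
(* Equal values would both be negative, because their sum [f] has a pole; then [q] would divide
   1. *)
- have [|m Em] := vAS; first by rewrite -E orbb in v_ge; apply: le_lt_trans v_ge vf.
  by case: (mulz_neq_small q (v g - m) 1) => //; move: Em; rewrite E vwg mulrBr; lia.
Qed.

Lemma sqr_notin_artin_schreier_mod w q : (2 < q)%N -> w != 0 -> v w = -1 ->
  ~ artin_schreier_mod K w q (w ^+ 2).
Proof.
move=> q2 w0 vw /(val_artin_schreier_mod w q _ (ltnW q2) w0 vw).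
rewrite expf_neq0 // valX // vw => /(_ isT isT) [m [] E].
  by case: (mulz_neq_small q m (-2)) => //; lia.
by case: (mulz_neq_small q m (-1)) => //; lia.
Qed.

Lemma expr_pow_inj w q : (1 < q)%N -> w != 0 -> v w != 0 ->
  injective (fun n => w ^+ (q ^ n)).
Proof.
move=> q1 w0 vw m n /(congr1 v); rewrite !valX // => /(mulIf vw) [].
exact: expnI.
Qed.

(** If [n > m], the difference of the two monomials has pole order p^n + 1, which is prime to [p]
    since [n > 0]; an Artin-Schreier element has no such pole. *)
Lemma artin_schreier_digits w p d e : prime p -> p \in [pchar K] ->
  w != 0 -> v w = -1 ->
  artin_schreier K p (w ^+ (p ^ d + 1) - w ^+ (p ^ e + 1)) -> d = e.
Proof.
move=> p_pr charKp w0 vw.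
have charp : [pchar K].-nat p by rewrite pnatE.
have no_lt m n : (m < n)%N ->
    ~ artin_schreier K p (w ^+ (p ^ n + 1) - w ^+ (p ^ m + 1)).
  move=> lt_mn [r Er].
  have p1 := prime_gt1 p_pr.
  have lt_pow : (p ^ m < p ^ n)%N by rewrite ltn_exp2l.
  have wn0 : w ^+ (p ^ n + 1) != 0 by rewrite expf_neq0.
  have wm0 : - w ^+ (p ^ m + 1) != 0 by rewrite oppr_eq0 expf_neq0.
  have lt_v : v (w ^+ (p ^ n + 1)) < v (- w ^+ (p ^ m + 1)).
    by rewrite valN ?expf_neq0 // !valX // vw; lia.
  have [] := val_lt _ _ wn0 wm0 lt_v.
  rewrite Er => r0; rewrite valX // vw => vr.
  have [|k] := val_artin_schreier p r p1 r0; first by rewrite vr; lia.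
  rewrite vr; case: n lt_mn {lt_pow wn0 lt_v Er r0 vr} => // n _; rewrite expnS => E.
  by case: (mulz_neq_small p (- k - (p ^ n)%N%:Z) 1); rewrite ?p1 // mulrBr; lia.
move=> H; case: (ltngtP d e) => // lt_de; last by case: (no_lt _ _ lt_de).
case: (no_lt _ _ lt_de).
(* The instance at 0 and 0 only says that 0 lies in the group; subtracting [H] from it reverses the
   sign. *)
have := artin_schreierB _ _ charp _ _ (artin_schreier_frobenius _ _ charp 0 0) H.
by rewrite expn0 expr1 subr0 sub0r opprB.
Qed.

Lemma artin_schreier_distn w p b i j : prime p -> p \in [pchar K] ->
  w != 0 -> v w = -1 ->
  artin_schreier K p (w ^+ (p ^ i) * w ^+ (p ^ j) - w ^+ (p ^ b) * w) <->
  ((i - j) + (j - i))%N = b.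
Proof.
move=> p_pr charKp w0 vw.
have charp : [pchar K].-nat p by rewrite pnatE.
have H := artin_schreier_monomial _ _ charp w i j.
rewrite -exprSr -exprD -addn1; split=> [H' | <- //].
apply: (artin_schreier_digits w p _ _ p_pr charKp w0 vw).
have := artin_schreierB _ _ charp _ _ H' H.
by congr (artin_schreier K p _); ring.
Qed.

End Valuation.

(** * Defining addition and divisibility of exponents at a simple pole *)

Definition frobenius_orbit (K : fieldType) (w : K) (p : nat) (x : K) :=
  exists s, (0 < s)%N /\ x = w ^+ (p ^ s).

Definition add_graph (K : fieldType) (w : K) (p : nat) (x y z : K) :=
  exists a b, [/\ (0 < a)%N, (0 < b)%N &
    [/\ x = w ^+ (p ^ a), y = w ^+ (p ^ b) & z = w ^+ (p ^ (a + b))]].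

Definition dvd_graph (K : fieldType) (w : K) (p : nat) (x y : K) :=
  exists a b, [/\ (0 < a)%N, (0 < b)%N, (a %| b)%N &
    x = w ^+ (p ^ a) /\ y = w ^+ (p ^ b)].

Lemma first_order_add (K : fieldType) (w : K) (p : nat) (v : K -> int) :
  (forall x y : K, x != 0 -> y != 0 -> v (x * y) = v x + v y) ->
  (forall x y : K, x != 0 -> y != 0 -> x + y != 0 ->
     Num.min (v x) (v y) <= v (x + y)) ->
  prime p -> p \in [pchar K] -> w != 0 -> v w = -1 ->
  first_order K (fun xs => frobenius_orbit K w p xs`_0) ->
  first_order K (fun xs => add_graph K w p xs`_0 xs`_1 xs`_2).
Proof.
move=> vM vD p_pr charKp w0 vw fP.
have fPi i : first_order K (fun xs => frobenius_orbit K w p xs`_i).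
  exact: (first_order_subst _ _ [:: 'X_i]%T fP).
have fAS i j k : first_order K (fun xs =>
    artin_schreier K p (xs`_i * xs`_j - xs`_k * w)).
  (* The witness [r] is prepended as ['X_0], which shifts the other indices by one. *)
  exact: (first_order_ex K _ (first_order_eq K
    ('X_i.+1 * 'X_j.+1 - 'X_k.+1 * w%:T) ('X_0 ^+ p - 'X_0))%T).
apply: (first_order_ext K (fun xs => frobenius_orbit K w p xs`_0 /\
  (frobenius_orbit K w p xs`_1 /\ (frobenius_orbit K w p xs`_2 /\
  (artin_schreier K p (xs`_2 * xs`_0 - xs`_1 * w) /\
   artin_schreier K p (xs`_2 * xs`_1 - xs`_0 * w)))))); last first.
  by do !apply: first_order_and.
move=> xs; move: xs`_0 xs`_1 xs`_2 => x y z.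
have dist := artin_schreier_distn K v vM vD w p _ _ _ p_pr charKp w0 vw.
split.
  move=> [[a [a0 ->]] [[b [b0 ->]] [[c [c0 ->]] [/dist ca /dist cb]]]].
  (* Besides c = a + b, the two distances allow only a = b with c = 0, which [0 < c] excludes. *)
  by exists a, b; split=> //; split=> //; congr (w ^+ (p ^ _)); lia.
move=> [a [b [a0 b0 [-> -> ->]]]].
split; first by exists a.
split; first by exists b.
split; first by exists (a + b)%N; rewrite addn_gt0 a0.
by split; apply/dist; lia.
Qed.

(* For [z = w ^+ (p ^ c)], [z' = w ^+ ((p ^ 2) ^ c)] and this says that [c] lies
   in the set coded by [u]. With [p] instead of [p ^ 2], [w ^+ 2] would lie in
   the subgroup when [p = 2]. *)
Definition coded (K : fieldType) (w : K) (p : nat) (z u : K) :=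
  exists z', add_graph K w p z z z' /\
    ~ artin_schreier_mod K w (p ^ 2) (u * z').

(* [M] need not be finite: this is why arbitrary elements [u] of [K], not only
   codes of finite sets, are harmless in the definition of divisibility. *)
Lemma dvdn_descent (M : nat -> Prop) a b : (0 < a)%N -> (0 < b)%N -> M b ->
  (forall c, (0 < c)%N -> M c ->
     c = a \/ exists d, [/\ (0 < d)%N, c = (a + d)%N & M d]) ->
  (a %| b)%N.
Proof.
move=> a0 + + step; have [n] := ubnP b; elim: n b => // n IHn b lt_b b0 Mb.
case: (step b b0 Mb) => [-> // | [d [d0 Eb Md]]].
by rewrite Eb dvdn_addr // IHn //; lia.
Qed.

(** Definable addition serves twice: it doubles [c], which passes from base [p] to base [p ^ 2], and
    it expresses the step from [c - a] to [c]. *)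
Lemma first_order_dvd (K : fieldType) (w : K) (p : nat) (v : K -> int) :
  (forall x y : K, x != 0 -> y != 0 -> v (x * y) = v x + v y) ->
  (forall x y : K, x != 0 -> y != 0 -> x + y != 0 ->
     Num.min (v x) (v y) <= v (x + y)) ->
  prime p -> p \in [pchar K] -> w != 0 -> v w = -1 ->
  first_order K (fun xs => frobenius_orbit K w p xs`_0) ->
  first_order K (fun xs => dvd_graph K w p xs`_0 xs`_1).
Proof.
move=> vM vD p_pr charKp w0 vw fP.
have fadd := first_order_add K w p v vM vD p_pr charKp w0 vw fP.
have fPi i : first_order K (fun xs => frobenius_orbit K w p xs`_i).
  exact: (first_order_subst _ _ [:: 'X_i]%T fP).
have faddi i j k : first_order K (fun xs => add_graph K w p xs`_i xs`_j xs`_k).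
  exact: (first_order_subst _ _ [:: 'X_i; 'X_j; 'X_k]%T fadd).
have fcoded i j : first_order K (fun xs => coded K w p xs`_i xs`_j).
  apply: (first_order_ex K (fun xs => add_graph K w p xs`_i.+1 xs`_i.+1 xs`_0 /\
    ~ artin_schreier_mod K w (p ^ 2) (xs`_j.+1 * xs`_0))).
  apply: first_order_and => //; apply: first_order_not.
  apply: (first_order_ex K (fun xs => exists g,
    xs`_j.+2 * xs`_1 = xs`_0 ^+ (p ^ 2) - xs`_0 + w * g ^+ (p ^ 2))).
  exact: (first_order_ex K _ (first_order_eq K ('X_j.+3 * 'X_2)
    ('X_1 ^+ (p ^ 2) - 'X_1 + w%:T * 'X_0 ^+ (p ^ 2)))%T).
apply: (first_order_ext K (fun xs => frobenius_orbit K w p xs`_0 /\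
  exists u, coded K w p xs`_1 u /\ forall z, coded K w p z u ->
    z = xs`_0 \/ exists z', add_graph K w p xs`_0 z' z /\ coded K w p z' u));
  last first.
  apply: first_order_and => //.
  apply: (first_order_ex K (fun xs => coded K w p xs`_2 xs`_0 /\
    forall z, coded K w p z xs`_0 -> z = xs`_1 \/
      exists z', add_graph K w p xs`_1 z' z /\ coded K w p z' xs`_0)).
  apply: first_order_and => //.
  apply: (first_order_all K (fun xs => coded K w p xs`_0 xs`_1 ->
    xs`_0 = xs`_2 \/
      exists z', add_graph K w p xs`_2 z' xs`_0 /\ coded K w p z' xs`_1)).
  apply: first_order_imp => //; apply: first_order_or.
    exact: (first_order_eq K 'X_0 'X_2)%T.
  apply: (first_order_ex K (fun xs =>
    add_graph K w p xs`_3 xs`_0 xs`_1 /\ coded K w p xs`_0 xs`_2)).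
  exact: first_order_and.
move=> xs; move: xs`_0 xs`_1 => x y.
have p1 := prime_gt1 p_pr.
have vw0 : v w != 0 by rewrite vw.
have inj := expr_pow_inj K v vM w p p1 w0 vw0.
(* The quantifier over [z] runs over all of K, but only elements of the orbit can satisfy
   [coded]. *)
have coded_pos z u : coded K w p z u -> frobenius_orbit K w p z.
  by move=> [_ [[a [_ [a0 _ [-> _ _]]]] _]]; exists a.
split.
  move=> [[a [a0 ->]] [u [cu step]]].
  have [b [b0 Ey]] := coded_pos _ _ cu.
  exists a, b; split=> //; move: cu; rewrite Ey => cu.
  apply: (dvdn_descent (fun c => coded K w p (w ^+ (p ^ c)) u)) => // c c0 /step.
  case=> [/inj -> | [z' [[a' [d [_ d0 [/inj <- -> /inj ->]]] cd]]]]; first by left.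
  by right; exists d.
move=> [a [b [a0 b0 /dvdnP[k Eb] [-> ->]]]]; split; first by exists a.
pose s := [seq (i * a)%N | i <- iota 1 k].
have q2 : (2 < p ^ 2)%N by apply: (@leq_trans (2 ^ 2)); rewrite ?leq_sqr.
have charq : [pchar K].-nat (p ^ 2)%N by rewrite pnatX pnatE // charKp.
have s_uniq : uniq s.
  by rewrite map_inj_uniq ?iota_uniq // => i j /eqP; rewrite eqn_pmul2r // => /eqP.
exists (\sum_(i <- s) w ^+ ((p ^ 2) ^ i)).
have w2 := sqr_notin_artin_schreier_mod K v vM vD w _ q2 w0 vw.
have codedP c : (0 < c)%N ->
    coded K w p (w ^+ (p ^ c)) (\sum_(i <- s) w ^+ ((p ^ 2) ^ i)) <-> c \in s.
  move=> c0; rewrite -(artin_schreier_mod_code K _ charq w s c s_uniq w2).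
  have E : (p ^ (c + c) = (p ^ 2) ^ c)%N by rewrite -expnM mul2n addnn.
  split=> [[z' [[a' [b' [_ _ [/inj <- /inj <- ->]]]]]] | H]; first by rewrite E.
  by exists (w ^+ (p ^ (c + c))); split; [exists c, c | rewrite E].
split.
  apply/codedP => //; apply/mapP; exists k; rewrite // mem_iota.
  by move: b0; rewrite Eb muln_gt0 => /andP[k0 _]; lia.
move=> z cz; have [c [c0 Ez]] := coded_pos _ _ cz.
move: cz; rewrite Ez => /codedP -/(_ c0) /mapP[i]; rewrite mem_iota => i_k Ec.
(* The first multiple is [a] itself; for [i > 1] the predecessor [i.-1 * a] is still listed in
   [s]. *)
have [i1 | i1] := eqVneq i 1%N; first by left; rewrite Ec i1 mul1n.
right; exists (w ^+ (p ^ (i.-1 * a))).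
have ia0 : (0 < i.-1 * a)%N by rewrite muln_gt0 a0; lia.
split.
  exists a, (i.-1 * a)%N; split=> //; split=> //.
  by rewrite Ec -mulSn prednK //; lia.
apply/codedP => //; apply/mapP; exists i.-1; rewrite // mem_iota; lia.
Qed.

Theorem theorem2p7 (F K : fieldType) (iota : {rmorphism F -> K}) (p : nat) (t : K) :
  prime p -> p \in [pchar K] ->
  function_field_one_var iota -> alg_closed_in iota ->
  ~ (exists c : F, t = iota c) ->
  ~ (exists y : K, t = y ^+ p) ->
  (exists v : K -> int, prime_valuation iota v /\ (v t = 1 \/ v t = -1)) ->
  definable (fun x : 1.-tuple K => exists s : nat, (0 < s)%N /\ tnth x ord0 = t ^+ (p ^ s)) ->
  [/\ {in [pred s : nat | (0 < s)%N] &, injective (fun s : nat => t ^+ (p ^ s))},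
      definable (fun x : 3.-tuple K => exists a b : nat, [/\ (0 < a)%N, (0 < b)%N &
          x = [tuple t ^+ (p ^ a); t ^+ (p ^ b); t ^+ (p ^ (a + b))]])
    & definable (fun x : 2.-tuple K => exists a b : nat, [/\ (0 < a)%N, (0 < b)%N, (a %| b)%N &
          x = [tuple t ^+ (p ^ a); t ^+ (p ^ b)]])].
Proof.
move=> p_pr charKp _ _ t_nconst _ [v [[vM vD _ _] vt]] dP.
have t0 : t != 0.
  by apply/eqP => t_eq0; apply: t_nconst; exists 0; rewrite t_eq0 rmorph0.
have vt0 : v t != 0 by case: vt => ->.
have fP := definable1_first_order K (frobenius_orbit K t p) dP.
suff [fadd fdvd] : first_order K (fun xs => add_graph K t p xs`_0 xs`_1 xs`_2) /\
    first_order K (fun xs => dvd_graph K t p xs`_0 xs`_1).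
  split.
  - by move=> m n _ _; apply: (expr_pow_inj K v vM t p (prime_gt1 p_pr) t0 vt0).
  - have [f Hf] := first_order_definable K 3 _ fadd; exists f => x; rewrite -Hf.
    case/tupleP: x => x0 x; case/tupleP: x => x1 x; case/tupleP: x => x2 x.
    rewrite (tuple0 x) /=; split=> -[a [b [a0 b0]]].
      by case/(congr1 val) => -> -> ->; exists a, b.
    by move=> [-> -> ->]; exists a, b; split=> //; apply: val_inj.
  - have [f Hf] := first_order_definable K 2 _ fdvd; exists f => x; rewrite -Hf.
    case/tupleP: x => x0 x; case/tupleP: x => x1 x.
    rewrite (tuple0 x) /=; split=> -[a [b [a0 b0 ab]]].
      by case/(congr1 val) => -> ->; exists a, b.
    by move=> [-> ->]; exists a, b; split=> //; apply: val_inj.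
(* A simple pole allows [w = t]. At a simple zero [w] is [t^-1], whose orbit consists of the
   inverses of the orbit of [t]; substituting inverses carries definability both ways. *)
case: vt => vt; last first.
  split; first exact: (first_order_add K t p v).
  exact: (first_order_dvd K t p v).
have w0 : t^-1 != 0 by rewrite invr_eq0.
have vw : v t^-1 = -1.
  have := valX K v vM 1 0 (oner_neq0 _); rewrite expr0 mul0r -(divff t0) vM // vt.
  lia.
(* Inversion, with [0^-1 = 0], is injective on all of K, so the substituted formulas need no
   nonvanishing condition. *)
have invE (x : K) n : x^-1 = t^-1 ^+ n <-> x = t ^+ n.
  by rewrite exprVn; split=> [/invr_inj | ->].
have fQ : first_order K (fun xs => frobenius_orbit K t^-1 p xs`_0).
  apply: first_order_ext (first_order_subst K _ [:: ('X_0)^-1]%T fP) => xs /=.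
  by split=> -[s [s0 E]]; exists s; split=> //; rewrite ?E exprVn -?E invrK.
split.
  have fadd := first_order_add K t^-1 p v vM vD p_pr charKp w0 vw fQ.
  apply: first_order_ext (first_order_subst K _
    [:: ('X_0)^-1; ('X_1)^-1; ('X_2)^-1]%T fadd) => xs /=.
  by split=> -[a [b [a0 b0 [/invE Ex /invE Ey /invE Ez]]]]; exists a, b.
have fdvd := first_order_dvd K t^-1 p v vM vD p_pr charKp w0 vw fQ.
apply: first_order_ext (first_order_subst K _
  [:: ('X_0)^-1; ('X_1)^-1]%T fdvd) => xs /=.
by split=> -[a [b [a0 b0 ab [/invE Ex /invE Ey]]]]; exists a, b.
Qed.
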